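(* Let $R$ be a commutative ring with $1$. The functor $\mathcal S:\mathbf{BA}\to\mathbf{Sp}_R$ is left adjoint to the functor $\mathcal I:\mathbf{Sp}_R\to\mathbf{BA}$.
   Context: All algebras are commutative and unital and all algebra homomorphisms are unital. For a commutative $R$-algebra $S$, $\mathrm{Id}(S)$ is the set of idempotents of $S$, a Boolean algebra under $e\vee f=e+f-ef$, $e\wedge f=ef$, $\lnot e=1-e$. A nonzero idempotent $e\in S$ is faithful if for each $a\in R$, $ae=0$ implies $a=0$. A faithful generating algebra of idempotents of $S$ is a Boolean subalgebra $B$ of $\mathrm{Id}(S)$ that generates $S$ as an $R$-algebra and all of whose nonzero elements are faithful. $S$ is a Specker $R$-algebra if it is a commutative $R$-algebra that has a faithful generating algebra of idempotents. For a Boolean algebra $B$, $R[B]$ denotes the quotient $R[\{x_e: e\in B\}]/I_B$ of the polynomial ring over $R$ in variables indexed by $B$ modulo the ideal $I_B$ generated by the elements $x_{e\wedge f}-x_ex_f$, $x_{e\vee f}-(x_e+x_f-x_ex_f)$, $x_{\lnot e}-(1-x_e)$, $x_0$, as $e,f$ range over $B$; put $y_e=x_e+I_B$. $R[B]$ is a Specker $R$-algebra. $\mathbf{BA}$ is the category of Boolean algebras and Boolean homomorphisms; $\mathbf{Sp}_R$ is the category of Specker $R$-algebras and $R$-algebra homomorphisms. The functor $\mathcal I$ sends $S$ to $\mathrm{Id}(S)$ and $\alpha:S\to S'$ to its restriction $\alpha|_{\mathrm{Id}(S)}$. The functor $\mathcal S$ sends $B$ to $R[B]$ and a Boolean homomorphism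 $\sigma:B\to B'$ to the $R$-algebra homomorphism $R[B]\to R[B']$ with $y_e\mapsto y_{\sigma(e)}$. *)

(* Defs.v *)
From HB Require Import structures.
From mathcomp Require Import all_boot all_order all_algebra.
From mathcomp Require Import boolp classical_sets.
From mathcomp Require Import finmap.
From mathcomp.multinomials Require Import monalg.

Set Implicit Arguments.
Unset Strict Implicit.
Unset Printing Implicit Defensive.

Import Order.Theory GRing.Theory.
Local Open Scope ring_scope.

Record category := Category {
  obj :> Type;
  arrow : obj -> obj -> Type;
  idmor : forall a, arrow a a;
  compmor : forall a b c, arrow b c -> arrow a b -> arrow a c;
  comp1mor : forall a b (f : arrow a b), compmor (idmor b) f = f;
  compmor1 : forall a b (f : arrow a b), compmor f (idmor a) = f;
  compmorA : forall a b c d (h : arrow c d) (g : arrow b c) (f : arrow a b),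
    compmor h (compmor g f) = compmor (compmor h g) f
}.

Record functor (C D : category) := Functor {
  fobj :> C -> D;
  fmor : forall a b, arrow a b -> arrow (fobj a) (fobj b);
  fmor1 : forall a, fmor (idmor a) = idmor (fobj a);
  fmorM : forall a b c (g : arrow b c) (f : arrow a b),
    fmor (compmor g f) = compmor (fmor g) (fmor f)
}.

Definition left_adjoint (C D : category) (F : functor C D) (G : functor D C) :
    Prop :=
  exists phi : forall (c : C) (d : D), arrow (F c) d -> arrow c (G d),
    [/\ forall c d, bijective (phi c d),
        forall c c' d (f : arrow c' c) (g : arrow (F c) d),
          phi c' d (compmor g (fmor F f)) = compmor (phi c d g) f
      & forall c d d' (h : arrow d d') (g : arrow (F c) d),
          phi c d' (compmor h g) = compmor (fmor G h) (phi c d g)].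

(* A commutative R-algebra is a commutative ring with a structure morphism
   from R, and a : R acts on s as alg_map a * s. The library's comAlgType
   requires 1 != 0, whereas the zero algebra has to be allowed here: it is
   R[B] for the one-element Boolean algebra B. *)
HB.mixin Record isPzComAlg (R : comPzRingType) S of GRing.ComPzRing S := {
  alg_map : {rmorphism R -> S}
}.

#[short(type="pzComAlgType")]
HB.structure Definition PzComAlg (R : comPzRingType) :=
  { S of GRing.ComPzRing S & isPzComAlg R S }.

Section AlgTheory.
Variables (R : comPzRingType) (S : pzComAlgType R).

Definition alg_hom (S' : pzComAlgType R) (f : S -> S') : Prop :=
  [/\ GRing.zmod_morphism f, GRing.monoid_morphism f
    & forall a : R, f (alg_map a) = alg_map a].

Definition subalgebra (A : S -> Prop) : Prop :=
  [/\ forall a : R, A (alg_map a), forall u v, A u -> A v -> A (u - v)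
    & forall u v, A u -> A v -> A (u * v)].

End AlgTheory.

Definition Id (S : comPzRingType) := {e : S | e * e == e}.
Definition mkId (S : comPzRingType) (e : S) (ee : e * e == e) : Id S :=
  exist _ e ee.

Fact Id_display : Order.disp_t. Proof. exact: Order.Disp tt tt. Qed.

Section Idempotents.
Variable S : comPzRingType.
Implicit Types e f g : Id S.

Lemma IdP e : val e * val e = val e. Proof. exact/eqP/(valP e). Qed.

Lemma Id_meet_subproof e f :
  (val e * val f) * (val e * val f) == val e * val f.
Proof. by rewrite mulrACA !IdP. Qed.

Lemma idem_compl (z : S) : z * z = z -> (1 - z) * (1 - z) = 1 - z.
Proof. by move=> zz; rewrite mulrBr mulr1 mulrBl mul1r zz subrr subr0. Qed.

Lemma Id_compl_subproof e : (1 - val e) * (1 - val e) == 1 - val e.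
Proof. exact/eqP/idem_compl/IdP. Qed.

Lemma joinE (u v : S) : u + v - u * v = 1 - (1 - u) * (1 - v).
Proof.
rewrite mulrBl mul1r mulrBr mulr1 !opprB.
by rewrite [RHS]addrC -[RHS]addrA subrK addrAC.
Qed.

Lemma Id_join_subproof e f :
  (val e + val f - val e * val f) * (val e + val f - val e * val f) ==
  val e + val f - val e * val f.
Proof.
rewrite joinE; apply/eqP/idem_compl.
by rewrite mulrACA !idem_compl ?IdP.
Qed.

Lemma Id_bot_subproof : (0 : S) * 0 == 0. Proof. by rewrite mulr0. Qed.
Lemma Id_top_subproof : (1 : S) * 1 == 1. Proof. by rewrite mulr1. Qed.

Definition Id_meet e f : Id S := mkId (Id_meet_subproof e f).
Definition Id_join e f : Id S := mkId (Id_join_subproof e f).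
Definition Id_compl e : Id S := mkId (Id_compl_subproof e).
Definition Id_bot : Id S := mkId Id_bot_subproof.
Definition Id_top : Id S := mkId Id_top_subproof.
Definition Id_le e f := Id_meet e f == e.
Definition Id_lt e f := (f != e) && Id_le e f.

Lemma Id_meetC : commutative Id_meet.
Proof. by move=> e f; apply/val_inj; rewrite /= mulrC. Qed.
Lemma Id_joinC : commutative Id_join.
Proof. by move=> e f; apply/val_inj; rewrite /= [val f + _]addrC [val f * _]mulrC. Qed.
Lemma Id_meetA : associative Id_meet.
Proof. by move=> e f g; apply/val_inj; rewrite /= mulrA. Qed.
Lemma Id_joinE e f : val (Id_join e f) = 1 - (1 - val e) * (1 - val f).
Proof. exact: joinE. Qed.
Lemma Id_joinA : associative Id_join.
Proof.
move=> e f g; apply/val_inj; rewrite !Id_joinE.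
by rewrite !opprD !opprK !addrA subrr !add0r mulrA.
Qed.
Lemma Id_joinKI f e : Id_meet e (Id_join e f) = e.
Proof.
apply/val_inj; rewrite /= mulrBr mulrDr IdP mulrA IdP.
by rewrite addrK.
Qed.
Lemma Id_meetKU f e : Id_join e (Id_meet e f) = e.
Proof. by apply/val_inj; rewrite /= mulrA IdP addrK. Qed.
Lemma Id_meetUl : left_distributive Id_meet Id_join.
Proof.
move=> e f g; apply/val_inj; rewrite /= mulrBl mulrDl.
by congr (_ - _); rewrite mulrACA IdP.
Qed.
Lemma Id_meetxx : idempotent_op Id_meet.
Proof. by move=> e; apply/val_inj; exact: IdP. Qed.

HB.instance Definition _ := Choice.on (Id S).
HB.instance Definition _ :=
  Order.isMeetJoinDistrLattice.Build Id_display (Id S)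
    (le := Id_le) (lt := Id_lt) (fun _ _ => erefl) (fun _ _ => erefl)
    Id_meetC Id_joinC Id_meetA Id_joinA Id_joinKI Id_meetKU Id_meetUl Id_meetxx.

Lemma Id_le0x e : (Id_bot <= e)%O.
Proof. by apply/eqP/val_inj; rewrite /= mul0r. Qed.
Lemma Id_lex1 e : (e <= Id_top)%O.
Proof. by apply/eqP/val_inj; rewrite /= mulr1. Qed.

HB.instance Definition _ :=
  Order.hasBottom.Build Id_display (Id S) Id_le0x.
HB.instance Definition _ :=
  Order.hasTop.Build Id_display (Id S) Id_lex1.

Lemma Id_joinxC e : Order.join e (Id_compl e) = Order.top.
Proof.
apply/val_inj => /=.
by rewrite mulrBr mulr1 IdP subrr subr0 addrC subrK.
Qed.
Lemma Id_meetxC e : Order.meet e (Id_compl e) = Order.bottom.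
Proof. by apply/val_inj => /=; rewrite mulrBr mulr1 IdP subrr. Qed.

HB.instance Definition _ :=
  Order.TBDistrLattice_hasComplement.Build Id_display (Id S)
    Id_joinxC Id_meetxC.

Lemma val_Id_meet e f : val (Order.meet e f) = val e * val f.
Proof. by []. Qed.
Lemma val_Id_join e f : val (Order.join e f) = val e + val f - val e * val f.
Proof. by []. Qed.
Lemma val_Id_compl e : val (Order.compl e) = 1 - val e.
Proof. by []. Qed.
Lemma val_Id_bot : val (Order.bottom : Id S) = 0. Proof. by []. Qed.
Lemma val_Id_top : val (Order.top : Id S) = 1. Proof. by []. Qed.

End Idempotents.

Section BooleanNotions.
Local Open Scope order_scope.

Definition boolean_hom d d' (B : ctbDistrLatticeType d)
    (B' : ctbDistrLatticeType d') (s : B -> B') : Prop :=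
  [/\ {morph s : x y / x `&` y}, {morph s : x y / x `|` y},
      {morph s : x / ~` x}, s \bot = \bot & s \top = \top].

Definition boolean_subalgebra d (B : ctbDistrLatticeType d) (A : B -> Prop) :
    Prop :=
  [/\ forall e f, A e -> A f -> A (e `&` f),
      forall e f, A e -> A f -> A (e `|` f),
      forall e, A e -> A (~` e), A \bot & A \top].

End BooleanNotions.

Section Specker.
Variables (R : comPzRingType) (S : pzComAlgType R).

Definition faithful_idem (e : Id S) : Prop :=
  forall a : R, alg_map a * val e = 0 -> a = 0.

Definition generates (B : Id S -> Prop) : Prop :=
  forall A : S -> Prop, subalgebra A -> (forall e, B e -> A (val e)) ->
  forall s, A s.

Definition faithful_generating_algebra (B : Id S -> Prop) : Prop :=
  [/\ boolean_subalgebra B, generates B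
    & forall e, B e -> val e <> 0 -> faithful_idem e].

Definition is_specker : Prop :=
  exists B : Id S -> Prop, faithful_generating_algebra B.

End Specker.

(* {malg R[{cmonom I}]} carries a ring structure in the library only when
   1 != 0 in R; the same operations are defined here without this assumption. *)
Definition polyring (R : comPzRingType) (I : choiceType) : Type :=
  {malg R[{cmonom I}]}.

HB.instance Definition _ (R : comPzRingType) (I : choiceType) :=
  GRing.Zmodule.copy (polyring R I) {malg R[{cmonom I}]}.

HB.lock Definition pterm (R : comPzRingType) (I : choiceType)
    (c : R) (m : {cmonom I}) : polyring R I := << c *g m >>.

HB.lock Definition poly_mul (R : comPzRingType) (I : choiceType)
    (p q : polyring R I) : polyring R I :=
  \sum_(m <- msupp p) \sum_(n <- msupp q) pterm (p@_m * q@_n) (mmul m n).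

Section PolyRing.
Variables (R : comPzRingType) (I : choiceType).
Implicit Types (c a b : R) (p q r : polyring R I) (m n : {cmonom I}).

Local Notation "c %:m m" := (pterm c m)
  (at level 35, m at level 34).

Lemma polyE p : p = \sum_(m <- msupp p) p@_m %:m m.
Proof. by rewrite pterm.unlock [LHS]monalgE. Qed.

Lemma ptermB m a b : (a - b) %:m m = a %:m m - b %:m m.
Proof. by rewrite pterm.unlock monalgUB. Qed.

Lemma ptermD m a b : (a + b) %:m m = a %:m m + b %:m m.
Proof. by rewrite pterm.unlock monalgUD. Qed.

Lemma pterm0 m : 0 %:m m = 0 :> polyring R I.
Proof. by rewrite pterm.unlock monalgU0. Qed.

Lemma poly_ind (Q : polyring R I -> Prop) :
  (forall c m, Q (c %:m m)) -> (forall p q, Q p -> Q q -> Q (p + q)) ->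
  forall p, Q p.
Proof.
move=> Qm QD p; rewrite [p]polyE; elim/big_ind: _ => //.
by rewrite -(pterm0 mone); apply: Qm.
Qed.

Section AdditiveExtension.
Variables (V : zmodType) (F : {cmonom I} -> R -> V).
Hypothesis FD : forall m, {morph F m : a b / a + b}.

Definition addext p : V := \sum_(m <- msupp p) F m p@_m.

Lemma addext_F0 m : F m 0 = 0.
Proof. by apply: (addrI (F m 0)); rewrite -FD !addr0. Qed.

Lemma addextw (D : {fset {cmonom I}}) p : (msupp p `<=` D)%fset ->
  addext p = \sum_(m <- D) F m p@_m.
Proof.
move=> sD; apply/big_fset_incl => // m _ /mcoeff_outdom ->.
exact: addext_F0.
Qed.

Lemma addextD p q : addext (p + q) = addext p + addext q.
Proof.
rewrite (addextw (fsubsetUl (msupp p) (msupp q))).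
rewrite (addextw (fsubsetUr (msupp p) (msupp q))).
rewrite (addextw (msuppD_le p q)) -big_split /=.
by apply/eq_bigr => m _; rewrite mcoeffD FD.
Qed.

Lemma addextU c m : addext (c %:m m) = F m c.
Proof. by rewrite pterm.unlock (addextw msuppU_le) big_seq_fset1 mcoeffUU. Qed.

Lemma addext0 : addext 0 = 0.
Proof. by rewrite /addext msupp0 big_seq_fset0. Qed.

End AdditiveExtension.

Definition poly_one : polyring R I := 1 %:m mone.

Let mulF q m c : polyring R I := \sum_(n <- msupp q) (c * q@_n) %:m (mmul m n).

Let mulFD q m : {morph mulF q m : a b / a + b}.
Proof.
move=> a b; rewrite -big_split /=; apply/eq_bigr => n _.
by rewrite mulrDl ptermD.
Qed.

Lemma poly_mulDl : left_distributive (@poly_mul R I) +%R.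
Proof. by move=> p q r; rewrite poly_mul.unlock; apply: (addextD (mulFD r)). Qed.

Lemma poly_mulUU a b m n :
  poly_mul (a %:m m) (b %:m n) = (a * b) %:m (mmul m n).
Proof.
rewrite poly_mul.unlock [LHS](addextU (mulFD _)).
apply: (addextU (F := fun n c => (a * c) %:m (mmul m n))) => k c d.
by rewrite mulrDr ptermD.
Qed.

Lemma poly_mulC : commutative (@poly_mul R I).
Proof.
move=> p q; rewrite poly_mul.unlock exchange_big /=.
by apply/eq_bigr => m _; apply/eq_bigr => n _; rewrite mulrC mulmC.
Qed.

Lemma poly_mulDr : right_distributive (@poly_mul R I) +%R.
Proof. by move=> p q r; rewrite ![poly_mul p _]poly_mulC poly_mulDl. Qed.

Lemma poly_mulA : associative (@poly_mul R I).
Proof.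
move=> p q r; elim/poly_ind: p => [a m|p p' Hp Hp']; last first.
  by rewrite !poly_mulDl Hp Hp'.
elim/poly_ind: q => [b n|q q' Hq Hq']; last first.
  move: Hq Hq'; move: (a %:m m) => x Hq Hq'.
  by rewrite !(poly_mulDl, poly_mulDr) Hq Hq'.
elim/poly_ind: r => [c k|r r' Hr Hr']; last first.
  move: Hr Hr'; move: (a %:m m) (b %:m n) => x y Hr Hr'.
  by rewrite !poly_mulDr Hr Hr'.
by rewrite !poly_mulUU mulrA mulmA.
Qed.

Lemma poly_mul1 : left_id poly_one (@poly_mul R I).
Proof.
move=> p; elim/poly_ind: p => [a m|p q Hp Hq]; last by rewrite poly_mulDr Hp Hq.
by rewrite poly_mulUU mul1r mul1m.
Qed.

HB.instance Definition _ := GRing.Zmodule_isComPzRing.Build (polyring R I)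
  poly_mulA poly_mulC poly_mul1 poly_mulDl.

Definition pconst c : polyring R I := c %:m mone.

Lemma pconst_zmod : GRing.zmod_morphism pconst.
Proof. by move=> a b; rewrite /pconst ptermB. Qed.
Lemma pconst_monoid : GRing.monoid_morphism pconst.
Proof. by split=> // a b; rewrite [RHS]poly_mulUU mul1m. Qed.
HB.instance Definition _ :=
  GRing.isZmodMorphism.Build R (polyring R I) pconst pconst_zmod.
HB.instance Definition _ :=
  GRing.isMonoidMorphism.Build R (polyring R I) pconst pconst_monoid.

HB.instance Definition _ := isPzComAlg.Build R (polyring R I) pconst.

Definition pvar (i : I) : polyring R I := pterm 1 (ucm i).

Variables (S : pzComAlgType R) (h : I -> S).

Definition meval m : S := \prod_(i <- finsupp m) h i ^+ m i.

Definition peval p : S := \sum_(m <- msupp p) alg_map p@_m * meval m.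

Let evalFD m : {morph (fun a : R => alg_map a * meval m) : a b / a + b}.
Proof. by move=> a b; rewrite rmorphD mulrDl. Qed.

Lemma mevalw (D : {fset I}) m : (finsupp m `<=` D)%fset ->
  meval m = \prod_(i <- D) h i ^+ m i.
Proof.
move=> sD; apply/big_fset_incl => // i _.
by rewrite -cmE_eq0 => /eqP ->; rewrite expr0.
Qed.

Lemma mevalM m n : meval (mmul m n) = meval m * meval n.
Proof.
rewrite (mevalw (fsubsetUl (finsupp m) (finsupp n))).
rewrite (mevalw (fsubsetUr (finsupp m) (finsupp n))).
rewrite (mevalw (m := mmul m n) (D := (finsupp m `|` finsupp n)%fset)).
  by rewrite -big_split /=; apply/eq_bigr => i _; rewrite cmM exprD.
by rewrite mdomD.
Qed.

Lemma meval1 : meval mone = 1.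
Proof. by rewrite /meval mdom1 big_seq_fset0. Qed.

Lemma pevalD p q : peval (p + q) = peval p + peval q.
Proof. exact: (addextD evalFD). Qed.

Lemma peval0 : peval 0 = 0. Proof. exact: (addext0 (fun m a => alg_map a * meval m)). Qed.

Lemma pevalN p : peval (- p) = - peval p.
Proof. by apply/eqP; rewrite -addr_eq0 -pevalD addNr peval0. Qed.

Lemma pevalB p q : peval (p - q) = peval p - peval q.
Proof. by rewrite pevalD pevalN. Qed.

Lemma pevalU c m : peval (c %:m m) = alg_map c * meval m.
Proof. exact: (addextU evalFD). Qed.

Lemma peval1 : peval 1 = 1.
Proof. by rewrite [peval 1]pevalU meval1 rmorph1 mul1r. Qed.

Lemma pevalM p q : peval (p * q) = peval p * peval q.
Proof.
elim/poly_ind: p => [b m|p p' Hp Hp']; last first.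
  by rewrite mulrDl !pevalD mulrDl Hp Hp'.
elim/poly_ind: q => [c n|q q' Hq Hq']; last first.
  by rewrite !(mulrDr, pevalD) Hq Hq'.
rewrite [_ * _]poly_mulUU !pevalU mevalM rmorphM.
by rewrite mulrACA.
Qed.

Lemma pevalC a : peval (pconst a) = alg_map a.
Proof. by rewrite pevalU meval1 mulr1. Qed.

Lemma peval_alg_hom : alg_hom peval.
Proof. by split; [exact: pevalB|split; [exact: peval1|exact: pevalM]|exact: pevalC]. Qed.

Lemma pevalX i : peval (pvar i) = h i.
Proof. by rewrite [LHS]pevalU rmorph1 mul1r /meval mdomU big_seq_fset1 cmUU. Qed.

End PolyRing.

Lemma polyring_gen (R : comPzRingType) (I : choiceType)
    (A : polyring R I -> Prop) :
  subalgebra A -> (forall i, A (pvar R i)) -> forall p, A p.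
Proof.
case=> AC AB AM AX; have A0 : A 0 by rewrite -(rmorph0 (alg_map : R -> polyring R I)).
have A1 : A 1 by apply: (AC 1).
have AD p q : A p -> A q -> A (p + q).
  by move=> Ap Aq; rewrite -[q]opprK; apply: (AB) => //; rewrite -sub0r; apply: (AB).
apply: poly_ind => // c m.
have -> : pterm c m = pconst I c * (pterm 1 m : polyring R I).
  by rewrite [RHS]poly_mulUU mulr1 mul1m.
apply: (AM); first exact: (AC c).
have -> : (pterm 1 m : polyring R I) = meval (@pvar R I) m.
  apply/esym; rewrite /meval.
  have AXn (i : I) n : pvar R i ^+ n = pterm 1 (iter n (mmul (ucm i)) mone).
    elim: n => [|n IHn]; first by [].
    by rewrite exprS IHn [LHS]poly_mulUU mulr1.
  rewrite (eq_bigr _ (fun i _ => AXn i _)).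
  rewrite -(big_morph (fun m : {cmonom I} => (pterm 1 m : polyring R I))
     (id1 := 1) (op1 := *%R) (id2 := mone) (op2 := mmul)); last 2 first.
  - by move=> x y; rewrite [RHS]poly_mulUU mulr1.
  - by [].
  congr (pterm _ _); apply/eqP/cmP => j.
  rewrite (big_morph (fun m : {cmonom I} => m j)
    (id1 := 0%N) (op1 := addn)); last 2 first.
  - by move=> x y; rewrite cmM.
  - by rewrite cm1.
  have itE i n : (iter n (mmul (ucm i)) mone : {cmonom I}) j = (n * (i == j))%N.
    elim: n => [|n IHn]; first by rewrite cm1.
    by rewrite /= cmM IHn cmU mulSn.
  rewrite (eq_bigr _ (fun i _ => itE i _)).
  have [jm|jm] := boolP (j \in finsupp m).
    rewrite (big_fsetD1 j) //= eqxx muln1 big1_fset ?addn0 // => i.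
    by rewrite in_fsetD1 => /andP[/negPf -> _] _; rewrite muln0.
  rewrite big1_fset; first by move: jm; rewrite -cmE_eq0 => /eqP.
  move=> i im _; case: eqP => [ij|]; last by rewrite muln0.
  by rewrite ij (negPf jm) in im.
rewrite /meval; elim/big_ind: _ => // i _.
by elim: (m i) => [|n IHn]; rewrite ?expr0 // exprS; apply: (AM).
Qed.

Section Quotient.
Variables (R : comPzRingType) (P : pzComAlgType R).

Definition is_ideal (J : P -> Prop) : Prop :=
  [/\ J 0, forall u v, J u -> J v -> J (u + v) & forall a u, J u -> J (a * u)].

Definition ideal_gen (G : P -> Prop) (p : P) : Prop :=
  forall J, is_ideal J -> (forall g, G g -> J g) -> J p.

Definition ideal_pred (G : P -> Prop) : {pred P} := fun p => `[< ideal_gen G p >].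

Variable G : P -> Prop.

Lemma ideal_genP : is_ideal (ideal_gen G).
Proof.
split=> [J []//|u v Iu Iv J JI GJ|a u Iu J JI GJ]; case: (JI) => J0 JD JM.
  by apply: JD; [apply: Iu|apply: Iv].
by apply: JM; apply: Iu.
Qed.

Lemma ideal_pred_zmod : zmod_closed (ideal_pred G).
Proof.
have [J0 JD JM] := ideal_genP; split; first exact/asboolP.
move=> u v /asboolP Ju /asboolP Jv; apply/asboolP; apply: JD => //.
by rewrite -mulN1r; apply: JM.
Qed.

HB.instance Definition _ := GRing.isZmodClosed.Build P (ideal_pred G)
  ideal_pred_zmod.

Definition quot_alg : Type := Quotient.quot (ideal_pred G).

HB.instance Definition _ := GRing.Zmodule.copy quot_alg
  (Quotient.quot (ideal_pred G)).

Definition qpi (p : P) : quot_alg := \pi_(Quotient.quot (ideal_pred G))%qT p.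
Definition qrepr (x : quot_alg) : P := repr (x : Quotient.quot (ideal_pred G)).

Lemma qreprK x : qpi (qrepr x) = x. Proof. exact: reprK. Qed.

Lemma qpi_eq p q : qpi p = qpi q <-> ideal_gen G (p - q).
Proof.
split=> [pq|pq].
  apply/asboolP; have /eqP := pq; rewrite -[_ == _]/(_ == _ %[mod Quotient.quot (ideal_pred G)])%qT.
  by rewrite -Quotient.idealrBE.
apply/eqP; rewrite -[_ == _]/(_ == _ %[mod Quotient.quot (ideal_pred G)])%qT.
by rewrite -Quotient.idealrBE; apply/asboolP.
Qed.

Lemma qpi0 : qpi 0 = 0. Proof. exact: raddf0. Qed.
Lemma qpiD p q : qpi (p + q) = qpi p + qpi q. Proof. exact: raddfD. Qed.
Lemma qpiB p q : qpi (p - q) = qpi p - qpi q. Proof. exact: raddfB. Qed.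

Lemma qpi_reprB p : ideal_gen G (qrepr (qpi p) - p).
Proof. by apply/qpi_eq; rewrite qreprK. Qed.

Definition qmul x y : quot_alg := qpi (qrepr x * qrepr y).

Lemma qpiM p q : qpi (p * q) = qmul (qpi p) (qpi q).
Proof.
apply/esym/qpi_eq; have [J0 JD JM] := ideal_genP.
set p' := qrepr _; set q' := qrepr _.
have -> : p' * q' - p * q = q' * (p' - p) + p * (q' - q).
  by rewrite !mulrBr ![q' * _]mulrC addrA subrK.
by apply: JD; apply: JM; apply: qpi_reprB.
Qed.

Lemma qpi_ind (Q : quot_alg -> Prop) : (forall p, Q (qpi p)) -> forall x, Q x.
Proof. by move=> Qp x; rewrite -[x]qreprK. Qed.

Lemma qmulA : associative qmul.
Proof.
elim/qpi_ind=> p; elim/qpi_ind=> q; elim/qpi_ind=> r.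
by rewrite -!qpiM mulrA.
Qed.
Lemma qmulC : commutative qmul.
Proof. by move=> x y; rewrite /qmul mulrC. Qed.
Lemma qmul1 : left_id (qpi 1) qmul.
Proof. by elim/qpi_ind=> p; rewrite -qpiM mul1r. Qed.
Lemma qmulDl : left_distributive qmul +%R.
Proof.
elim/qpi_ind=> p; elim/qpi_ind=> q; elim/qpi_ind=> r.
by rewrite -qpiD -!qpiM mulrDl qpiD.
Qed.
HB.instance Definition _ := GRing.Zmodule_isComPzRing.Build quot_alg
  qmulA qmulC qmul1 qmulDl.

Definition qconst (a : R) : quot_alg := qpi (alg_map a).

Lemma qconst_zmod : GRing.zmod_morphism qconst.
Proof. by move=> a b; rewrite /qconst rmorphB qpiB. Qed.
Lemma qconst_monoid : GRing.monoid_morphism qconst.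
Proof.
split; first by rewrite /qconst rmorph1.
by move=> a b; rewrite /qconst rmorphM qpiM.
Qed.
HB.instance Definition _ :=
  GRing.isZmodMorphism.Build R quot_alg qconst qconst_zmod.
HB.instance Definition _ :=
  GRing.isMonoidMorphism.Build R quot_alg qconst qconst_monoid.

HB.instance Definition _ := isPzComAlg.Build R quot_alg qconst.

Lemma qpi_alg_hom : alg_hom qpi.
Proof.
split; [exact: qpiB|split; [by []|exact: qpiM]|by []].
Qed.

Lemma quot_lift (S : pzComAlgType R) (f : P -> S) :
  alg_hom f -> (forall g, G g -> f g = 0) -> alg_hom (f \o qrepr) /\
  forall p, f (qrepr (qpi p)) = f p.
Proof.
move=> [fB [f1 fM] fC] fG.
have f0 : f 0 = 0 by rewrite -(subrr 0) fB subrr.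
have fN v : f (- v) = - f v by rewrite -sub0r fB f0 sub0r.
have fD u v : f (u + v) = f u + f v by rewrite -{1}[v]opprK fB fN opprK.
have fK p : f (qrepr (qpi p)) = f p.
  apply/eqP; rewrite -subr_eq0 -fB; apply/eqP.
  apply: (@qpi_reprB p (fun u => f u = 0)) => //.
  by split=> // [u v|a u]; rewrite (fD, fM) => ->; [move=> ->; rewrite addr0|rewrite mulr0].
split=> //; split.
- elim/qpi_ind=> p; elim/qpi_ind=> q.
  by rewrite -qpiB /= !fK fB.
- split; first by rewrite [LHS]fK.
  elim/qpi_ind=> p; elim/qpi_ind=> q.
  by rewrite -[qpi p * _]qpiM /= !fK fM.
- by move=> a; rewrite [LHS]fK fC.
Qed.

End Quotient.

Section AlgOfBA.
Local Open Scope order_scope.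
Variables (R : comPzRingType) (d : Order.disp_t) (B : ctbDistrLatticeType d).

Local Notation x := (@pvar R B).

Variant BA_relator : polyring R B -> Prop :=
| Relator_meet e f : BA_relator (x (e `&` f) - x e * x f)%R
| Relator_join e f : BA_relator (x (e `|` f) - (x e + x f - x e * x f))%R
| Relator_compl e : BA_relator (x (~` e) - (1 - x e))%R
| Relator_bot : BA_relator (x \bot).

(* The algebra R[B], with generators ygen e = y_e. *)
Definition alg_of_BA : pzComAlgType R := quot_alg BA_relator.

Definition ygen (e : B) : alg_of_BA := qpi BA_relator (x e).

Definition boolean_rep (S : pzComAlgType R) (h : B -> S) : Prop :=
  [/\ forall e f, h (e `&` f) = (h e * h f)%R,
      forall e f, h (e `|` f) = (h e + h f - h e * h f)%R,
      forall e, h (~` e) = (1 - h e)%R & h \bot = 0%R].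

Lemma ygen_rep : boolean_rep ygen.
Proof.
have [yB [y1 yM] yC] := qpi_alg_hom BA_relator.
have yD := qpiD BA_relator.
have E p q : BA_relator (p - q)%R -> qpi BA_relator p = qpi BA_relator q.
  by move=> pq; apply/qpi_eq => J _; apply.
split.
- by move=> e f; rewrite /ygen (E _ _ (Relator_meet e f)) yM.
- by move=> e f; rewrite /ygen (E _ _ (Relator_join e f)) yB yD yM.
- by move=> e; rewrite /ygen (E _ _ (Relator_compl e)) yB y1.
- rewrite /ygen (E (x \bot) 0%R) ?qpi0 // subr0.
  exact: Relator_bot.
Qed.

Lemma ygen_gen (A : alg_of_BA -> Prop) :
  subalgebra A -> (forall e, A (ygen e)) -> forall u, A u.
Proof.
have [yB [y1 yM] yC] := qpi_alg_hom BA_relator.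
move=> [AC AB AM] Ay; elim/qpi_ind=> p.
pose A' p := A (qpi BA_relator p).
apply: (@polyring_gen R B A') => //; split.
- by move=> a; rewrite /A' yC; apply: AC.
- by move=> u v Au Av; rewrite /A' yB; apply: AB.
- by move=> u v Au Av; rewrite /A' yM; apply: AM.
Qed.

Lemma alg_hom_ygen_inj (S : pzComAlgType R) (f g : alg_of_BA -> S) :
  alg_hom f -> alg_hom g -> (forall e, f (ygen e) = g (ygen e)) ->
  forall u, f u = g u.
Proof.
move=> [fB [f1 fM] fC] [gB [g1 gM] gC] fg.
apply: ygen_gen => //; split.
- by move=> a; rewrite fC gC.
- by move=> u v Hu Hv; rewrite fB gB Hu Hv.
- by move=> u v Hu Hv; rewrite fM gM Hu Hv.
Qed.

Section Extension.
Variables (S : pzComAlgType R) (h : B -> S).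

Definition ygen_ext (u : alg_of_BA) : S := peval h (qrepr u).

Hypothesis hP : boolean_rep h.

Lemma ygen_ext_kill p : BA_relator p -> peval h p = 0%R.
Proof.
have [hI hU hC h0] := hP; have [pB [p1 pM] pC] := peval_alg_hom h.
case=> [e f|e f|e|].
- by rewrite pB pM !pevalX hI subrr.
- by rewrite 2!pB pevalD pM !pevalX hU subrr.
- by rewrite 2!pB p1 !pevalX hC subrr.
- by rewrite pevalX h0.
Qed.

Lemma ygen_ext_alg_hom : alg_hom ygen_ext.
Proof. exact: (quot_lift (peval_alg_hom h) ygen_ext_kill).1. Qed.

Lemma ygen_extE e : ygen_ext (ygen e) = h e.
Proof.
by rewrite -[RHS]pevalX; apply: (quot_lift (peval_alg_hom h) ygen_ext_kill).2.
Qed.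

End Extension.

Lemma ultrafilter_exists (e : B) : e <> \bot ->
  exists U : B -> Prop,
    [/\ U e, forall a b, U (a `&` b) <-> U a /\ U b & forall a, U (~` a) <-> ~ U a].
Proof.
move=> e0.
pose filt (A : set B) := [/\ A e, ~ A \bot,
  forall a b, A a -> A b -> A (a `&` b) & forall a b, A a -> a <= b -> A b].
pose P (A : set B) : Prop := A = classical_sets.set0 \/ filt A.
have [A [PA Amax]] : exists A, P A /\ forall C, (A `<` C)%classic -> ~ P C.
  apply: Zorn_bigcup => F FP Ftot.
  have [[A0 [FA0 A0n]]|Fn] := pselect (exists A, F A /\ A !=set0)%classic; last first.
    left; rewrite -subset0 => a [A FA Aa]; apply: Fn; exists A; split=> //.
    by exists a.
  have PF A a : F A -> A a -> filt A.
    by move=> FA Aa; case: (FP A FA) => // A00; rewrite A00 in Aa.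
  right; case: A0n => a0 A0a0; have [A0e _ _ _] := PF _ _ FA0 A0a0; split.
  - by exists A0.
  - by case=> A FA Ab; have [_ ] := PF _ _ FA Ab.
  - move=> a b [A FA Aa] [C FC Cb].
    have [_ _ AI _] := PF _ _ FA Aa; have [_ _ CI _] := PF _ _ FC Cb.
    case: (Ftot A C FA FC) => s; first by exists C => //; apply: CI => //; apply: s.
    by exists A => //; apply: AI => //; apply: s.
  - move=> a b [A FA Aa] ab; exists A => //.
    by have [_ _ _ AU] := PF _ _ FA Aa; apply: AU ab.
have fA : filt A.
  case: PA => // A0; exfalso.
  pose C : set B := fun a => e <= a.
  apply: (Amax C); last first.
    right; split; rewrite /C /=.
    - exact: lexx.
    - by rewrite lex0 => /eqP.
    - by move=> a b; rewrite lexI => -> ->.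
    - by move=> a b; apply: le_trans.
  rewrite A0; split; first by move=> ? [].
  by move=> /(_ e (lexx e)).
have [Ae An AI AU] := fA.
have AC a : ~ A a -> A (~` a).
  move=> Na; pose C : set B := fun b => exists2 c, A c & c `&` a <= b.
  have AsC : (A `<` C)%classic.
    split; first by move=> b Ab; exists b => //; apply: leIl.
    by move=> /(_ a) H; apply/Na/H; exists e => //; apply: leIr.
  have [[c Ac ca]|Cn] := pselect (C \bot).
    apply: AU Ac _; move: ca; rewrite lex0 => /eqP ca.
    by rewrite -disj_leC ca.
  exfalso; apply: (Amax C AsC); right; split => //.
  - by exists e => //; apply: leIl.
  - move=> b b' [c Ac cb] [c' Ac' cb']; exists (c `&` c'); first exact: AI.
    rewrite lexI; apply/andP; split.
      by apply: le_trans cb; apply: leI2; rewrite ?leIl.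
    by apply: le_trans cb'; apply: leI2; rewrite ?leIr.
  - by move=> b b' [c Ac cb] bb'; exists c => //; apply: le_trans bb'.
exists A; split=> //.
- move=> a b; split=> [Aab|[Aa Ab]]; last exact: AI.
  by split; apply: AU Aab _; rewrite ?leIl ?leIr.
- move=> a; split; last exact: AC.
  by move=> Aca Aa; apply: An; rewrite -(meetxC a); apply: AI.
Qed.

Lemma ygen_faithful (e : B) : ygen e <> 0%R ->
  forall a : R, (alg_map a * ygen e = 0 -> a = 0)%R.
Proof.
have [yI yU yC y0] := ygen_rep.
move=> ye0 a aye; have [|U [Ue UI UC]] := @ultrafilter_exists e.
  by move=> e0; apply: ye0; rewrite e0.
pose h (b : B) : polyring R 'I_0 := (`[< U b >]%:R)%R.
have UJ b c : U (b `|` c) <-> U b \/ U c.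
  rewrite -[b `|` c]complK complU UC UI !UC; split=> [|[Hb [] //|Hc [] //]].
  by have [|Nb] := pselect (U b); [left|have [|Nc] := pselect (U c); [right|case]].
have hrep : boolean_rep h.
  rewrite /h; split.
  - by move=> b c; rewrite -natrM mulnb -asbool_and; congr (_%:R)%R; congr nat_of_bool; apply/asbool_equiv_eq/UI.
  - move=> b c; rewrite (asbool_equiv_eq (UJ b c)) asbool_or.
    by case: `[< U b >]; case: `[< U c >]; rewrite /= ?mulr1 ?mulr0 ?subr0 ?addr0 ?add0r ?addrK.
  - move=> b; rewrite (asbool_equiv_eq (UC b)) asbool_neg.
    by case: `[< U b >]; rewrite /= ?subrr ?subr0.
  - have /asboolPn : ~ U \bot by rewrite -(meetxC e) UI UC; case.
    by move=> /negPf ->.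
have [_ [_ fM] fC] := ygen_ext_alg_hom hrep.
have := congr1 (ygen_ext h) aye; rewrite fM fC (ygen_extE hrep) {1}/h.
have /asboolP -> := Ue; rewrite mulr1 => Ha.
have := congr1 (mcoeff mone) (Ha : pconst 'I_0 a = _).
have [fB _ _] := ygen_ext_alg_hom hrep.
rewrite -(subrr (0 : alg_of_BA))%R fB subrr.
by rewrite /pconst pterm.unlock mcoeffUU mcoeff0.
Qed.

Lemma alg_of_BA_specker : is_specker alg_of_BA.
Proof.
have [yI yU yC y0] := ygen_rep.
exists (fun e => exists b, val e = ygen b); split.
- split.
  + by move=> e f [b eb] [c fc]; exists (b `&` c); rewrite val_Id_meet eb fc yI.
  + by move=> e f [b eb] [c fc]; exists (b `|` c); rewrite val_Id_join eb fc yU.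
  + by move=> e [b eb]; exists (~` b); rewrite val_Id_compl eb yC.
  + by exists \bot; rewrite y0.
  + by exists (~` \bot); rewrite yC y0 subr0.
- move=> A AS Agen; apply: ygen_gen => // b.
  have bb : (ygen b * ygen b == ygen b)%R by rewrite -yI meetxx.
  by apply: (Agen (mkId bb)); exists b.
- by move=> e [b eb] e0 a; rewrite eb; apply: ygen_faithful; rewrite -eb.
Qed.

End AlgOfBA.

Record boolAlg := BoolAlg {
  BA_disp : Order.disp_t;
  BA_sort :> ctbDistrLatticeType BA_disp
}.

Definition BA_hom (B B' : boolAlg) : Type := {s : B -> B' | boolean_hom s}.

Lemma boolean_hom_id (B : boolAlg) : boolean_hom (@id B).
Proof. by []. Qed.

Lemma boolean_hom_comp (B B' B'' : boolAlg) (t : B' -> B'') (s : B -> B') :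
  boolean_hom t -> boolean_hom s -> boolean_hom (t \o s).
Proof.
move=> [tI tU tC t0 t1] [sI sU sC s0 s1].
by split=> [e f|e f|e||] /=; rewrite ?(sI, sU, sC, s0, s1) ?(tI, tU, tC, t0, t1).
Qed.

Definition BA_id (B : boolAlg) : BA_hom B B := exist _ _ (boolean_hom_id B).

Definition BA_comp (B B' B'' : boolAlg) (t : BA_hom B' B'') (s : BA_hom B B') :
    BA_hom B B'' :=
  exist _ _ (boolean_hom_comp (proj2_sig t) (proj2_sig s)).

Lemma sig_funext (T U : Type) (P : (T -> U) -> Prop) (f g : {f | P f}) :
  (forall t, sval f t = sval g t) -> f = g.
Proof.
case: f g => [f Pf] [g Pg] /= fg; have {}fg : f = g by apply/funext.
by subst g; rewrite (Prop_irrelevance Pf Pg).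
Qed.

Lemma BA_comp1 B B' (s : BA_hom B B') : BA_comp (BA_id B') s = s.
Proof. exact: sig_funext. Qed.
Lemma BA_compr1 B B' (s : BA_hom B B') : BA_comp s (BA_id B) = s.
Proof. exact: sig_funext. Qed.
Lemma BA_compA A B C D (u : BA_hom C D) (t : BA_hom B C) (s : BA_hom A B) :
  BA_comp u (BA_comp t s) = BA_comp (BA_comp u t) s.
Proof. exact: sig_funext. Qed.

Definition BA : category := Category BA_comp1 BA_compr1 BA_compA.

Section SpeckerCategory.
Variable R : comPzRingType.

Record speckerAlg := SpeckerAlg {
  Sp_sort :> pzComAlgType R;
  Sp_specker : is_specker Sp_sort
}.

Definition Sp_hom (S S' : speckerAlg) : Type := {f : S -> S' | alg_hom f}.

Lemma alg_hom_id (S : pzComAlgType R) : alg_hom (@id S).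
Proof. by []. Qed.

Lemma alg_hom_comp (S S' S'' : pzComAlgType R) (g : S' -> S'') (f : S -> S') :
  alg_hom g -> alg_hom f -> alg_hom (g \o f).
Proof.
move=> [gB [g1 gM] gC] [fB [f1 fM] fC]; split=> [u v|/=|a] /=.
- by rewrite fB gB.
- by split=> [|u v] /=; [rewrite f1 g1|rewrite fM gM].
- by rewrite fC gC.
Qed.

Definition Sp_id (S : speckerAlg) : Sp_hom S S := exist _ _ (alg_hom_id S).

Definition Sp_comp (S S' S'' : speckerAlg) (g : Sp_hom S' S'')
    (f : Sp_hom S S') : Sp_hom S S'' :=
  exist _ _ (alg_hom_comp (proj2_sig g) (proj2_sig f)).

Lemma Sp_comp1 S S' (f : Sp_hom S S') : Sp_comp (Sp_id S') f = f.
Proof. exact: sig_funext. Qed.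
Lemma Sp_compr1 S S' (f : Sp_hom S S') : Sp_comp f (Sp_id S) = f.
Proof. exact: sig_funext. Qed.
Lemma Sp_compA A B C D (h : Sp_hom C D) (g : Sp_hom B C) (f : Sp_hom A B) :
  Sp_comp h (Sp_comp g f) = Sp_comp (Sp_comp h g) f.
Proof. exact: sig_funext. Qed.

Definition Sp : category := Category Sp_comp1 Sp_compr1 Sp_compA.

Lemma Id_map_subproof (S S' : pzComAlgType R) (f : S -> S') (e : Id S) :
  alg_hom f -> f (val e) * f (val e) == f (val e).
Proof. by move=> [_ [_ fM] _]; rewrite -fM IdP. Qed.

Definition Id_map (S S' : Sp) (f : arrow S S') (e : Id S) : Id S' :=
  mkId (Id_map_subproof e (proj2_sig f)).

Lemma Id_map_boolean_hom (S S' : Sp) (f : arrow S S') : boolean_hom (Id_map f).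
Proof.
have [fB [f1 fM] fC] := proj2_sig f.
have f0 : sval f 0 = 0 by rewrite -(subrr 0) fB subrr.
have fN v : sval f (- v) = - sval f v by rewrite -sub0r fB f0 sub0r.
have fD u v : sval f (u + v) = sval f u + sval f v.
  by rewrite -{1}[v]opprK fB fN opprK.
split=> [a b|a b|a||]; apply/val_inj; rewrite /= ?fM //.
- by rewrite fB fD fM.
- by rewrite fB f1.
Qed.

Definition I_obj (S : Sp) : BA := BoolAlg (Id S).

Definition I_mor (S S' : Sp) (f : arrow S S') : arrow (I_obj S) (I_obj S') :=
  exist _ _ (Id_map_boolean_hom f).

Lemma I_mor1 (S : Sp) : I_mor (idmor S) = idmor (I_obj S).
Proof. by apply: sig_funext => e; apply/val_inj. Qed.

Lemma I_morM (S S' S'' : Sp) (g : arrow S' S'') (f : arrow S S') :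
  I_mor (compmor g f) = compmor (I_mor g) (I_mor f).
Proof. by apply: sig_funext => e; apply/val_inj. Qed.

Definition I_functor : functor Sp BA := Functor I_mor1 I_morM.

Definition S_obj (B : BA) : Sp := SpeckerAlg (alg_of_BA_specker R B).

Lemma boolean_hom_rep (B B' : BA) (s : arrow B B') :
  boolean_rep (fun e => ygen R (sval s e)).
Proof.
have [sI sU sC s0 s1] := proj2_sig s; have [yI yU yC y0] := @ygen_rep R _ B'.
by split=> [e f|e f|e|]; rewrite ?(sI, sU, sC, s0) ?(yI, yU, yC, y0).
Qed.

Definition S_mor (B B' : BA) (s : arrow B B') : arrow (S_obj B) (S_obj B') :=
  exist _ _ (ygen_ext_alg_hom (boolean_hom_rep s)).

Lemma S_morE (B B' : BA) (s : arrow B B') (e : B) :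
  sval (S_mor s) (ygen R e) = ygen R (sval s e).
Proof. exact: ygen_extE (boolean_hom_rep s) e. Qed.

Lemma S_hom_eq (B : BA) (S : Sp) (f g : arrow (S_obj B) S) :
  (forall e : B, sval f (ygen R e) = sval g (ygen R e)) -> f = g.
Proof.
move=> fg; apply: sig_funext.
exact: (alg_hom_ygen_inj (proj2_sig f) (proj2_sig g) fg).
Qed.

Lemma S_mor1 (B : BA) : S_mor (idmor B) = idmor (S_obj B).
Proof. by apply: S_hom_eq => e; rewrite S_morE. Qed.

Lemma S_morM (B B' B'' : BA) (t : arrow B' B'') (s : arrow B B') :
  S_mor (compmor t s) = compmor (S_mor t) (S_mor s).
Proof.
apply: S_hom_eq => e; rewrite [LHS]S_morE; apply/esym.
exact: etrans (congr1 (sval (S_mor t)) (S_morE s e)) (S_morE t _).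
Qed.

Definition S_functor : functor BA Sp := Functor S_mor1 S_morM.

End SpeckerCategory.

(* Main.v *)
Require Import Defs.
From mathcomp Require Import all_boot all_order all_algebra.

Set Implicit Arguments.
Unset Strict Implicit.
Unset Printing Implicit Defensive.

Import Order.Theory GRing.Theory.
Local Open Scope ring_scope.

(** The map [e |-> y_e] is a Boolean homomorphism [B -> Id (R[B])], natural in
    [B]; it is the unit of the adjunction. It is a universal arrow because a
    Boolean homomorphism [B -> Id S] is the same thing as a map [B -> S]
    satisfying the relations that present [R[B]]. *)

(** The hom-set bijection is [g |-> G g \o eta], with inverse [ext]. Naturality in [c] comes from
    that of [eta], naturality in [d] from functoriality of [G]. *)
Lemma left_adjoint_of_unit (C D : category) (F : functor C D) (G : functor D C)
    (eta : forall c : C, arrow c (G (F c)))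
    (ext : forall (c : C) (d : D), arrow c (G d) -> arrow (F c) d) :
  (forall (c c' : C) (f : arrow c' c),
      compmor (fmor G (fmor F f)) (eta c') = compmor (eta c) f) ->
  (forall c d (f : arrow c (G d)), compmor (fmor G (ext c d f)) (eta c) = f) ->
  (forall c d (g : arrow (F c) d), ext c d (compmor (fmor G g) (eta c)) = g) ->
  left_adjoint F G.
Proof.
move=> etaN extK Kext; exists (fun c d g => compmor (fmor G g) (eta c)); split.
- by move=> c d; exists (ext c d).
- by move=> c c' d f g; rewrite fmorM -compmorA etaN compmorA.
- by move=> c d d' h g; rewrite fmorM compmorA.
Qed.

Section Unit.
Variables (R : comPzRingType) (B : BA).

Lemma ygen_idem (e : B) : ygen R e * ygen R e == ygen R e.
Proof. by have [yI _ _ _] := @ygen_rep R _ B; rewrite -yI meetxx. Qed.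

Lemma Id_ygen_boolean_hom : boolean_hom (fun e : B => mkId (ygen_idem e)).
Proof.
have [yI yU yC y0] := @ygen_rep R _ B.
split=> [e f|e f|e||]; apply/val_inj => //=.
(* No relator mentions the top element; [y_1 = 1] follows from those for complement and bottom. *)
by rewrite -compl0 yC y0 subr0.
Qed.

Definition Id_ygen : arrow B (I_functor R (S_functor R B)) :=
  exist _ _ Id_ygen_boolean_hom.

(** The operations of [Id S] unfold to the very ring expressions in the relators. *)
Lemma val_boolean_rep (S : Sp R) (s : arrow B (I_functor R S)) :
  boolean_rep (fun e : B => val (sval s e)).
Proof.
by have [sI sU sC s0 _] := proj2_sig s; split=> [e f|e f|e|]; rewrite ?(sI, sU, sC, s0).
Qed.

Definition ygen_lift (S : Sp R) (s : arrow B (I_functor R S)) :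
    arrow (S_functor R B) S :=
  exist _ _ (ygen_ext_alg_hom (val_boolean_rep s)).

Lemma ygen_liftE (S : Sp R) (s : arrow B (I_functor R S)) (e : B) :
  sval (ygen_lift s) (ygen R e) = val (sval s e).
Proof. exact: ygen_extE (val_boolean_rep s) e. Qed.

End Unit.

Theorem lemma3p7 (R : comPzRingType) :
  left_adjoint (S_functor R) (I_functor R).
Proof.
apply: (left_adjoint_of_unit (eta := Id_ygen R) (ext := @ygen_lift R)).
- by move=> B B' s; apply: sig_funext => e; apply/val_inj; exact: S_morE.
- by move=> B S s; apply: sig_funext => e; apply/val_inj; exact: ygen_liftE.
(* The [y_e] generate [R[B]], so agreement on them suffices. *)
- by move=> B S g; apply: S_hom_eq => e; rewrite ygen_liftE.
Qed.
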